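(* Let $X,Y$ be real Hilbert spaces and $T:X\to Y$ a bounded linear operator as in the context. Let $l,m\in\mathbb{N}$ with $m\ge l/2$, let $\Phi$ be a concave index function, and let $\psi(s):=\sup_{t\ge 0}[st+\Phi(t)]$ denote the Fenchel conjugate of $-\Phi$. Let $f^\dagger\in X$ satisfy the variational source condition $\mathrm{VSC}^l(f^\dagger,\Phi)$. Then there exists a constant $C>0$ depending only on $l$ and $m$ such that $$\left\|\hat f_\alpha^{(m)}-f^\dagger\right\|^2\le C\left(\frac{\delta^2}{\alpha}+\alpha^{l-1}\psi\left(-\frac1\alpha\right)\right)\qquad\text{for all }\alpha,\delta>0,$$ where $\hat f_\alpha^{(m)}$ is the $m$-times iterated Tikhonov estimator computed from any data $g^{\mathrm{obs}}\in Y$ with $\|g^{\mathrm{obs}}-Tf^\dagger\|\le\delta$.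
   Context: Setting: $X,Y$ are real Hilbert spaces, $T:X\to Y$ is bounded, linear and injective, and $T^{-1}:T(X)\to X$ is not continuous. $\mathbb{N}=\{1,2,\dots\}$. Iterated Tikhonov regularization: for $\alpha>0$ and $g^{\mathrm{obs}}\in Y$ set $\hat f_\alpha^{(0)}:=0$ and, for $n\ge1$, let $\hat f_\alpha^{(n)}$ be the minimizer over $f\in X$ of $\frac{1}{2\alpha}\|Tf-g^{\mathrm{obs}}\|_Y^2+\frac12\|f-\hat f_\alpha^{(n-1)}\|_X^2$. An index function is a continuous increasing function $\Phi:[0,\infty)\to[0,\infty)$ with $\Phi(0)=0$. Variational source condition $\mathrm{VSC}^l(f^\dagger,\Phi)$ for $f^\dagger\in X$, a concave index function $\Phi$, and $n\in\mathbb N$: - $\mathrm{VSC}^{2n-1}(f^\dagger,\Phi)$: there exists $\overline\omega^{(n-1)}\in X$ with $f^\dagger=(T^*T)^{n-1}\overline\omega^{(n-1)}$ and, for all $f\in X$, $\langle\overline\omega^{(n-1)},f\rangle\le\frac12\|f\|^2+\Phi(\|Tf\|^2)$. - $\mathrm{VSC}^{2n}(f^\dagger,\Phi)$: there exists $\overline p^{(n)}\in Y$ with $f^\dagger=(T^*T)^{n-1}T^*\overline p^{(n)}$ and, for all $p\in Y$, $\langle p,\overline p^{(n)}\rangle\le\frac12\|p\|^2+\Phi(\|T^*p\|^2)$. *)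

(* Defs.v *)
From HB Require Import structures.
From mathcomp Require Import all_boot all_order all_algebra.
From mathcomp Require Import all_classical all_reals all_analysis.

Set Implicit Arguments.
Unset Strict Implicit.
Unset Printing Implicit Defensive.

Import Order.TTheory GRing.Theory Num.Theory.
Import numFieldNormedType.Exports.

Local Open Scope classical_set_scope.
Local Open Scope ring_scope.

(* Real Hilbert spaces: complete normed spaces whose norm is induced by a
   symmetric positive definite bilinear form. *)
HB.mixin Record CompleteNormedModule_isHilbert (R : realType) (V : Type)
    of CompleteNormedModule R V := {
  inner : {dot V for idfun} ;
  sqr_norm_inner : forall x : V, `|x| ^+ 2 = inner x x }.

#[short(type="hilbertType")]
HB.structure Definition Hilbert (R : realType) :=
  {V of CompleteNormedModule_isHilbert R V & CompleteNormedModule R V}.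

Notation "'<[ x , y ]>" := (inner x y) (format "''<[' x ,  y ]>") : ring_scope.

Section Operators.
Context {R : realType} {X Y : hilbertType R}.
Implicit Type T : X -> Y.

(* For bounded linear T the point selected exists and is unique, by the Riesz
   representation theorem; the default 0 is then never used. *)
Definition adjoint T (p : Y) : X :=
  xget 0 [set f | forall x, '<[T x, p]> = '<[x, f]>].

(* The inverse of an injective T; only its values on range T are meaningful. *)
Definition inverse T : Y -> X := 'pinv_(fun=> 0) setT T.

Definition tikhonov_functional T (alpha : R) (gobs : Y) (f0 f : X) : R :=
  (2 * alpha)^-1 * `|T f - gobs| ^+ 2 + 2^-1 * `|f - f0| ^+ 2.

(* For alpha > 0 and bounded linear T the minimizer exists and is unique. *)
Definition tikhonov_step T (alpha : R) (gobs : Y) (f0 : X) : X :=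
  xget 0 [set f | forall f', tikhonov_functional T alpha gobs f0 f
                          <= tikhonov_functional T alpha gobs f0 f'].

Definition iterated_tikhonov T (alpha : R) (gobs : Y) (n : nat) : X :=
  iter n (tikhonov_step T alpha gobs) 0.

Definition VSC_odd T (fdag : X) (Phi : R -> R) (n : nat) : Prop :=
  exists omega : X,
    fdag = iter n.-1 (adjoint T \o T) omega /\
    forall f : X, '<[omega, f]> <= 2^-1 * `|f| ^+ 2 + Phi (`|T f| ^+ 2).

Definition VSC_even T (fdag : X) (Phi : R -> R) (n : nat) : Prop :=
  exists pbar : Y,
    fdag = iter n.-1 (adjoint T \o T) (adjoint T pbar) /\
    forall p : Y, '<[p, pbar]> <= 2^-1 * `|p| ^+ 2 + Phi (`|adjoint T p| ^+ 2).

(* VSC_odd n and VSC_even n are the conditions of order 2n - 1 and 2n (n >= 1);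
   l = 2n - 1 gives n = (l + 1)/2 and l = 2n gives n = l/2. The value at l = 0
   has no meaning. *)
Definition VSC T (fdag : X) (Phi : R -> R) (l : nat) : Prop :=
  if odd l then VSC_odd T fdag Phi l.+1./2 else VSC_even T fdag Phi l./2.

End Operators.

Section IndexFunctions.
Context {R : realType}.
Implicit Type Phi : R -> R.

(* Functions on [0, +oo[ are total functions of which only the values at
   nonnegative arguments are used. "Increasing" is taken in the weak sense. *)
Definition index_function Phi : Prop :=
  [/\ Phi 0 = 0,
      forall t, 0 <= t -> 0 <= Phi t,
      forall s t, 0 <= s -> s <= t -> Phi s <= Phi t &
      {within `[0, +oo[, continuous Phi}].

Definition concave_on_nonneg Phi : Prop :=
  convex_function (`[0, +oo[ : set R) (fun t => - Phi t).

(* The Fenchel conjugate of -Phi, where -Phi is +oo on ]-oo, 0[; it may take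
   the value +oo. *)
Definition conjugate_opp Phi (s : R) : \bar R :=
  ereal_sup [set (s * t + Phi t)%:E | t in `[0, +oo[].

End IndexFunctions.

(* Main.v *)
(* With A = T^* T and R = alpha (A + alpha)^-1, the error e_n of the n-th iterate
   satisfies e_n = R e_(n-1) + w, where w = (A + alpha)^-1 T^* (gobs - T fdag)
   has norm at most delta / (2 sqrt alpha) and R is a contraction; so e_m differs
   from the bias - R^m fdag by at most m |w|.  Since |R A x| <= alpha |x|, the
   bias is at most alpha^k |R omega| when fdag = A^k omega with k < m.  Testing
   the source condition with R omega (odd l), resp. with one half of
   alpha (T T^* + alpha)^-1 pbar (even l, omega = T^* pbar), bounds |R omega|^2
   by 4 psi(-1/alpha), resp. 4 alpha psi(-1/alpha). *)

Require Import Defs.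
From mathcomp Require Import all_boot all_order all_algebra.
From mathcomp Require Import all_classical all_reals all_analysis.
From mathcomp Require Import zify ring lra.

Import Order.TTheory GRing.Theory Num.Theory.
Import numFieldNormedType.Exports.

Local Open Scope classical_set_scope.
Local Open Scope ring_scope.

(** * Calculus of the inner product *)

Section Inner.
Context {R : realType} {X : hilbertType R}.
Implicit Types (x y z : X) (a : R).

Lemma innerC x y : '<[x, y]> = '<[y, x]>.
Proof. by rewrite hermC /= expr0 mul1r. Qed.

Lemma innerDl x y z : '<[x + y, z]> = '<[x, z]> + '<[y, z]>.
Proof. exact: linearDl. Qed.

Lemma innerDr x y z : '<[z, x + y]> = '<[z, x]> + '<[z, y]>.
Proof. exact: linearDr. Qed.

Lemma innerNl x z : '<[- x, z]> = - '<[x, z]>.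
Proof. exact: linearNl. Qed.

Lemma innerNr x z : '<[z, - x]> = - '<[z, x]>.
Proof. exact: linearNr. Qed.

Lemma innerZl a x z : '<[a *: x, z]> = a * '<[x, z]>.
Proof. by rewrite linearZl_LR. Qed.

Lemma innerZr a x z : '<[z, a *: x]> = a * '<[z, x]>.
Proof. by rewrite innerC innerZl innerC. Qed.

Lemma inner0l z : '<[0, z]> = 0.
Proof. exact: linear0l. Qed.

Lemma inner0r z : '<[z, 0]> = 0.
Proof. exact: linear0r. Qed.

Definition innerE :=
  (innerDl, innerDr, innerNl, innerNr, innerZl, innerZr, inner0l, inner0r).

Lemma inner_ge0 x : 0 <= '<[x, x]>.
Proof. by rewrite -sqr_norm_inner sqr_ge0. Qed.

Lemma inner_eq0 x : '<[x, x]> = 0 -> x = 0.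
Proof.
by rewrite -sqr_norm_inner => /eqP; rewrite sqrf_eq0 normr_eq0 => /eqP.
Qed.

Lemma inner_injr x y : (forall z, '<[z, x]> = '<[z, y]>) -> x = y.
Proof.
move=> xy; apply/eqP; rewrite -subr_eq0; apply/eqP/inner_eq0.
by rewrite innerDr innerNr xy subrr.
Qed.

Lemma ler_norm_inner x y : '<[x, x]> <= '<[y, y]> -> `|x| <= `|y|.
Proof. by rewrite -!sqr_norm_inner ler_sqr ?nnegrE. Qed.

End Inner.

(** * Existence of minimizers and first-order conditions *)

(** The first-order condition at a minimum, without derivatives. With k > 0 and k >= c, the choice t
    = - b / (2 k) gives b^2 (c - 2 k) / (4 k^2), which is negative unless b = 0. *)
Lemma quadratic_ge0_linear_coef0 (R : realFieldType) (b c : R) :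
  (forall t, 0 <= t * b + t ^+ 2 * c) -> b = 0.
Proof.
move=> h; set k := `|c| + 1.
have k0 : 0 < k by rewrite ltr_wpDl.
have ck : c <= k by rewrite (le_trans (ler_norm c))// lerDl.
have := h (- b / (2 * k)).
have -> : - b / (2 * k) * b + (- b / (2 * k)) ^+ 2 * c =
  b ^+ 2 * (c - 2 * k) / (4 * k ^+ 2) by field; rewrite gt_eqF.
rewrite pmulr_lge0 ?invr_gt0 ?mulr_gt0 ?exprn_gt0// => h1.
have b2 : b ^+ 2 * k <= 0 by have := sqr_ge0 b; nra.
apply/eqP; rewrite -sqrf_eq0 eq_le sqr_ge0 andbT.
by rewrite -(pmulr_lle0 _ k0).
Qed.

(** The sublevel sets of J just above its infimum i generate a Cauchy filter: if J x and J y lie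
    below i + c e^2, then J >= i at the midpoint forces |x - y| < e. Completeness gives a limit, and
    continuity makes it a minimizer. *)
Lemma uniformly_convex_minimizer (R : realType) (X : completeNormedModType R)
    (J : X -> R) (c lb : R) :
  0 < c -> continuous J -> (forall x, lb <= J x) ->
  (forall x y, J (2^-1 *: (x + y)) <= 2^-1 * (J x + J y) - c * `|x - y| ^+ 2) ->
  exists x, forall y, J x <= J y.
Proof.
move=> c0 Jc Jlb Jcvx.
set i := inf (range J).
have hi : has_inf (range J).
  by split; [exists (J 0), 0 | exists lb => _ [x _ <-]].
have iJ x : i <= J x by apply: ge_inf; [exact: hi.2 | exists x].
pose D (e : R) := [set x | J x < i + e].
pose F := filter_from [set e : R | 0 < e] D.
have FF : ProperFilter F.
  apply: filter_from_proper.
    apply: filter_from_filter; first by exists 1; rewrite /= ltr01.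
    move=> e e' /= e0 e'0; exists (Num.min e e').
      by rewrite /= lt_min e0.
    move=> x; rewrite /D /= => xe; split; apply: (lt_le_trans xe);
    by rewrite lerD2l ge_min lexx ?orbT.
  move=> e /= e0; have [_ [x _ <-] xe] := inf_adherent e0 hi.
  by exists x.
have Fc : cauchy F.
  apply: cauchy_exP => e /= e0.
  have ce0 : 0 < c * e ^+ 2 by rewrite mulr_gt0 ?exprn_gt0.
  have [_ [x _ <-] xe] := inf_adherent ce0 hi.
  exists x, (c * e ^+ 2) => //= y ye.
  rewrite -ball_normE /= -(@ltr_pXn2r _ 2)// ?nnegrE ?(ltW e0)//.
  rewrite -(ltr_pM2l c0).
  have := iJ (2^-1 *: (x + y)); have := Jcvx x y.
  move: ye; rewrite /D /=; lra.
have /cauchy_cvgP/cvg_ex[x Fx] := Fc.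
exists x => y; apply: (le_trans _ (iJ y)).
apply/ler_addgt0Pr => e e0.
have JFx : J @ F --> J x by apply: continuous_cvg => //; exact: Jc.
apply: (cvgr_to_le JFx); exists e => // z /=.
exact: ltW.
Qed.

(** * The adjoint by Riesz representation *)

Section Adjoint.
Context {R : realType} {X Y : hilbertType R} (T : {linear X -> Y}).
Hypothesis Tb : bounded_near T (nbhs (0 : X)).

Let TD x y : T (x + y) = T x + T y. Proof. exact: linearD. Qed.
Let TN x : T (- x) = - T x. Proof. exact: linearN. Qed.
Let TZ a x : T (a *: x) = a *: T x. Proof. exact: linearZ_LR. Qed.
Let TE := (TD, TN, TZ).

Lemma bounded_inner : exists2 M : R, 0 < M &
  forall x, '<[T x, T x]> <= M * '<[x, x]>.
Proof.
have /linear_boundedP[r [_ rT]] := Tb.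
set M := `|r| + 1.
have M0 : 0 < M by rewrite ltr_wpDl.
exists (M ^+ 2); first exact: exprn_gt0.
move=> x; rewrite -!sqr_norm_inner -exprMn ler_sqr ?nnegrE ?mulr_ge0 ?(ltW M0)//.
by apply: rT; rewrite /M (le_lt_trans (ler_norm r))// ltrDl.
Qed.

(** The representing vector is the minimizer of |x|^2 / 2 - <T x, p>, whose first-order condition is
    the claim. *)
Lemma adjoint_exists p : exists z, forall x, '<[T x, p]> = '<[x, z]>.
Proof.
(* Polarization makes the continuity of '<[T x, p]> evident. *)
pose J x := 2^-1 * `|x| ^+ 2 - 4^-1 * (`|T x + p| ^+ 2 - `|T x - p| ^+ 2).
have JE x : J x = 2^-1 * '<[x, x]> - '<[T x, p]>.
  by rewrite /J !sqr_norm_inner !innerE (innerC p); field.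
have Tc : continuous T by exact/linear_bounded_continuous.
have Jc : continuous J.
  move=> x; rewrite /J.
  apply: cvgB; first by apply: cvgMr; apply: cvgM; apply: cvg_norm; apply: cvg_id.
  apply: cvgMr; apply: cvgB; apply: cvgM; apply: cvg_norm;
    by apply: cvgD; [exact: Tc|exact: cvg_cst].
have [M M0 TM] := bounded_inner.
(* The modulus 1/8 comes from the parallelogram law for |x|^2 / 2; the lower bound comes from |T x -
   M p|^2 >= 0 and |T x|^2 <= M |x|^2. *)
have [||||z zJ] := @uniformly_convex_minimizer R X J 8^-1
  (- (2^-1 * M * '<[p, p]>)).
- by rewrite invr_gt0.
- exact: Jc.
- move=> x; rewrite JE.
  have := inner_ge0 (T x - M *: p); rewrite !innerE (innerC p).
  have := TM x; have := inner_ge0 x.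
  move: '<[x, x]> '<[T x, T x]> '<[T x, p]> '<[p, p]> => a b d q a0 ba h.
  rewrite -subr_ge0 -(pmulr_rge0 _ M0); nra.
- move=> x y; rewrite !JE sqr_norm_inner !TE !innerE (innerC y x).
  lra.
exists z => x; apply/eqP; rewrite -subr_eq0 -oppr_eq0; apply/eqP.
apply: (@quadratic_ge0_linear_coef0 _ _ (2^-1 * '<[x, x]>)) => t.
have := zJ (z + t *: x); rewrite !JE !TE !innerE (innerC z x).
lra.
Qed.

Lemma adjointP x p : '<[T x, p]> = '<[x, adjoint T p]>.
Proof.
rewrite /adjoint; case: xgetP => [z _ /(_ x)//|].
by have [z zP] := adjoint_exists p => /(_ z).
Qed.

(** * The Tikhonov step and its normal equation *)

Variable alpha : R.
Hypothesis alpha0 : 0 < alpha.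
Local Notation step := (tikhonov_step T alpha).

(** The Euler-Lagrange equation of the functional, scaled by alpha: the weak form of (A + alpha) f =
    T^* g + alpha f0 for A = T^* T. *)
Lemma tikhonov_stepP g f0 h :
  '<[T (step g f0) - g, T h]> + alpha * '<[step g f0 - f0, h]> = 0.
Proof.
have Tc : continuous T by exact/linear_bounded_continuous.
set J := tikhonov_functional T alpha g f0.
have JE f : J f = 2^-1 * alpha^-1 * '<[T f - g, T f - g]> +
    2^-1 * '<[f - f0, f - f0]>.
  by rewrite /J /tikhonov_functional !sqr_norm_inner invfM.
have Jc : continuous J.
  move=> x; rewrite /J /tikhonov_functional.
  apply: cvgD; apply: cvgMr; apply: cvgM; apply: cvg_norm;
    by apply: cvgB; [exact: Tc || exact: cvg_id|exact: cvg_cst].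
have a20 : 0 < 2^-1 * alpha^-1 by rewrite mulr_gt0 ?invr_gt0.
have [||||z zJ] := @uniformly_convex_minimizer R X J 8^-1 0.
- by rewrite invr_gt0.
- exact: Jc.
- by move=> x; rewrite JE addr_ge0// mulr_ge0 ?inner_ge0 ?(ltW a20) ?invr_ge0.
- move=> x y; rewrite !JE sqr_norm_inner.
  have := mulr_ge0 (ltW a20) (inner_ge0 (T x - T y)).
  rewrite !TE !innerE.
  rewrite (innerC y x) (innerC (T y) (T x)).
  rewrite (innerC g) (innerC g) (innerC f0) (innerC f0).
  lra.
rewrite /tikhonov_step; case: xgetP => [f _ fJ|/(_ z)//].
have : alpha^-1 * '<[T f - g, T h]> + '<[f - f0, h]> = 0; last first.
  by move=> e; rewrite -[RHS](mulr0 alpha) -e mulrDr mulVKf ?gt_eqF.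
apply: (@quadratic_ge0_linear_coef0 _ _
  (2^-1 * (alpha^-1 * '<[T h, T h]> + '<[h, h]>))) => t.
have := fJ (f + t *: h); rewrite -!/J !JE !TE !innerE.
rewrite (innerC h) (innerC h) (innerC (T h)) (innerC (T h)).
lra.
Qed.

(** Uniqueness: the difference d of two solutions satisfies |T d|^2 + alpha |d|^2 = 0. *)
Lemma tikhonov_step_eq g f0 f :
  (forall h, '<[T f - g, T h]> + alpha * '<[f - f0, h]> = 0) -> step g f0 = f.
Proof.
move=> fP; apply/eqP; rewrite -subr_eq0; apply/eqP/inner_eq0.
set s := step g f0; have := tikhonov_stepP g f0 (s - f); have := fP (s - f).
rewrite -/s; set d := s - f.
have Td : '<[T s - T f, T d]> = '<[T d, T d]> by rewrite /d linearB.
have dd : '<[s - f, d]> = '<[d, d]> by [].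
have := inner_ge0 d; have := inner_ge0 (T d); move: Td dd.
rewrite !innerE -/s => Td dd T0 d0 e1 e2.
apply/eqP; rewrite eq_le d0 andbT -(pmulr_rle0 _ alpha0); nra.
Qed.

(** * The resolvent and its decay on the range of powers of A *)

Local Notation A := (adjoint T \o T).
(** With zero data the step is the linear map alpha (A + alpha)^-1. *)
Local Notation resolvent := (step 0).

Lemma resolventP x h :
  '<[T (resolvent x), T h]> + alpha * '<[resolvent x - x, h]> = 0.
Proof. by have := tikhonov_stepP 0 x h; rewrite subr0. Qed.

Lemma resolvent_eq x f :
  (forall h, '<[T f, T h]> + alpha * '<[f - x, h]> = 0) -> resolvent x = f.
Proof. by move=> fP; apply: tikhonov_step_eq => h; rewrite subr0. Qed.

Lemma resolventD x y : resolvent (x + y) = resolvent x + resolvent y.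
Proof.
apply: resolvent_eq => h.
have := resolventP x h; have := resolventP y h; rewrite !TE !innerE; lra.
Qed.

(** For r = [resolvent x], testing the equation with r gives alpha <x - r, r> = |T r|^2 >= 0, so
    |x|^2 >= |x - r|^2 + |r|^2. This also yields the next bound. *)
Lemma resolvent_contraction x : `|resolvent x| <= `|x|.
Proof.
apply: ler_norm_inner; have := resolventP x (resolvent x).
set r := resolvent x.
have := inner_ge0 (T r); have := inner_ge0 (x - r).
rewrite !innerE (innerC r x) => h1 h2 h3.
rewrite -subr_ge0 -(pmulr_rge0 _ alpha0).
by have := mulr_ge0 (ltW alpha0) h1; lra.
Qed.

Lemma norm_sub_resolvent x : `|x - resolvent x| <= `|x|.
Proof.
apply: ler_norm_inner; have := resolventP x (resolvent x).
set r := resolvent x.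
have := inner_ge0 (T r); have := inner_ge0 r.
rewrite !innerE (innerC r x) => h1 h2 h3.
rewrite -subr_ge0 -(pmulr_rge0 _ alpha0).
by have := mulr_ge0 (ltW alpha0) h1; lra.
Qed.

Lemma resolvent_normal x : resolvent (A x) = alpha *: (x - resolvent x).
Proof.
apply: resolvent_eq => h; have := resolventP x h.
have := adjointP h (T x); rewrite (innerC _ (T x)) (innerC h) => a e.
rewrite -[RHS](mulr0 (- alpha)) -e /= !TE !innerE -a; ring.
Qed.

Lemma normal_resolvent x : A (resolvent x) = alpha *: (x - resolvent x).
Proof.
apply: inner_injr => h /=; rewrite -adjointP.
by rewrite innerC innerZr (innerC h); have := resolventP x h; rewrite !innerE; lra.
Qed.

(** Each factor A is absorbed by one resolvent R through R A = alpha (1 - R), where 1 - R has norm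
    at most 1; the other j resolvents are kept. *)
Lemma norm_iter_resolvent_normal k j x :
  `|iter (k + j) resolvent (iter k A x)| <= alpha ^+ k * `|iter j resolvent x|.
Proof.
have comm n y : iter n resolvent (A y) = A (iter n resolvent y).
  by elim: n => //= n ->; rewrite -!/(A _) resolvent_normal normal_resolvent.
elim: k => [|k IH]; first by rewrite expr0 mul1r.
rewrite addSn /= -!/(A _) comm resolvent_normal normrZ gtr0_norm// exprS -mulrA.
by rewrite ler_pM2l// (le_trans (norm_sub_resolvent _)).
Qed.

Lemma norm_iter_resolvent_le j x : `|iter j.+1 resolvent x| <= `|resolvent x|.
Proof.
by elim: j => //= j IH; apply: le_trans (resolvent_contraction _) IH.
Qed.

(** * Splitting of the error into bias and propagated noise *)

(** The step is linear in data and starting point jointly, and it fixes f for the exact data T f. *)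
Lemma tikhonov_step_error xi f f0 :
  step (T f + xi) f0 - f = resolvent (f0 - f) + step xi 0.
Proof.
apply/eqP; rewrite subr_eq; apply/eqP; apply: tikhonov_step_eq => h.
have := resolventP (f0 - f) h; have := tikhonov_stepP xi 0 h.
rewrite !TE !innerE; lra.
Qed.

Lemma norm_tikhonov_step_noise xi :
  `|step xi 0| ^+ 2 <= `|xi| ^+ 2 / (4 * alpha).
Proof.
rewrite ler_pdivlMr ?mulr_gt0// !sqr_norm_inner.
have := tikhonov_stepP xi 0 (step xi 0); set w := step xi 0.
(* Testing with w gives alpha |w|^2 = <xi, T w> - |T w|^2, which is at most |xi|^2 / 4 by completing
   the square. *)
have := inner_ge0 (2 *: T w - xi); rewrite !innerE (innerC xi); lra.
Qed.

Lemma norm_iterated_tikhonov_error xi f m :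
  `|iterated_tikhonov T alpha (T f + xi) m - f + iter m resolvent f|
    <= m%:R * `|step xi 0|.
Proof.
elim: m => [|m IH] /=; first by rewrite sub0r addNr normr0 mul0r.
rewrite tikhonov_step_error addrAC -resolventD.
by rewrite -natr1 mulrDl mul1r (le_trans (ler_normD _ _))// lerD2r
  (le_trans (resolvent_contraction _)).
Qed.

(** * Bias bounds from the source conditions *)

(** Since <om, u> = |u|^2 + |T u|^2 / alpha for the resolvent u of om, the source condition at u
    bounds |u|^2 / 2. The constant 4 instead of 2 matches the even case, and a witness t in place of
    the supremum keeps the bound real-valued. *)
Lemma VSC_odd1_bound (Phi : R -> R) om :
  (forall f, '<[om, f]> <= 2^-1 * `|f| ^+ 2 + Phi (`|T f| ^+ 2)) ->
  exists2 t, 0 <= t &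
    `|resolvent om| ^+ 2 <= 4 * (- alpha^-1 * t + Phi t).
Proof.
set u := resolvent om => /(_ u) h; exists (`|T u| ^+ 2); first exact: sqr_ge0.
have := resolventP om u; rewrite -/u !innerE => e.
have e1 : '<[om, u]> = '<[u, u]> + alpha^-1 * '<[T u, T u]>.
  by apply: (mulfI (lt0r_neq0 alpha0)); rewrite mulrDr mulVKf ?gt_eqF//; lra.
move: h; rewrite e1 -!sqr_norm_inner; have := sqr_ge0 `|u|; lra.
Qed.

(* The test element is v / 2 for v = alpha (T T^* + alpha)^-1 p: testing with v
   itself would bound only |v|, while the factor 1/2 keeps part of the term
   |T^* v|^2 / alpha. *)
Lemma VSC_even1_bound (Phi : R -> R) p :
  (forall q, '<[q, p]> <= 2^-1 * `|q| ^+ 2 + Phi (`|adjoint T q| ^+ 2)) ->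
  exists2 t, 0 <= t &
    `|resolvent (adjoint T p)| ^+ 2 <= 4 * alpha * (- alpha^-1 * t + Phi t).
Proof.
(* Here u = (A + alpha)^-1 T^* p, so the residual v is alpha (T T^* + alpha)^-1 p and T^* v = alpha
   u. *)
set u := step p 0; set v := p - T u => hp.
have uP h : '<[v, T h]> = alpha * '<[u, h]>.
  by have := tikhonov_stepP p 0 h; rewrite -/u /v !innerE; lra.
have adjv a : adjoint T (a *: v) = (a * alpha) *: u.
  apply: inner_injr => h; rewrite -adjointP !innerZr (innerC (T h)) uP (innerC u).
  ring.
have -> : resolvent (adjoint T p) = alpha *: u.
  apply: resolvent_eq => h; have := uP h.
  rewrite /v !TE !innerE (innerC (adjoint T p)) -adjointP (innerC (T h)) => e.
  by rewrite mulrDr -e; ring.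
have pv : '<[v, p]> = '<[v, v]> + alpha * '<[u, u]>.
  by rewrite -uP -innerDr /v subrK.
exists (`|(2^-1 * alpha) *: u| ^+ 2); first exact: sqr_ge0.
have := hp (2^-1 *: v); rewrite adjv; move: (Phi _) => P.
rewrite !sqr_norm_inner !(innerZl, innerZr) pv.
have -> : - alpha^-1 * (2^-1 * alpha * (2^-1 * alpha * '<[u, u]>)) =
  - (alpha * '<[u, u]> / 4) by field; rewrite gt_eqF.
(* The source condition leaves 3/8 |v|^2 + alpha |u|^2 / 2 <= Phi t with t / alpha = alpha |u|^2 /
   4; the term in v is dropped. *)
have := inner_ge0 v.
move: '<[v, v]> '<[u, u]> => b a b0 h.
rewrite [4 * alpha]mulrC -!mulrA ler_pM2l//; lra.
Qed.

Lemma VSC_bias (Phi : R -> R) l m fdag : (0 < l)%N -> (l <= 2 * m)%N ->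
  VSC T fdag Phi l ->
  exists2 t, 0 <= t & `|iter m resolvent fdag| ^+ 2 <=
    4 * alpha ^+ l.-1 * (- alpha^-1 * t + Phi t).
Proof.
move=> l0 lm.
have bias k j x : `|iter (k + j.+1) resolvent (iter k A x)| ^+ 2 <=
    (alpha ^+ k) ^+ 2 * `|resolvent x| ^+ 2.
  rewrite -exprMn ler_sqr ?nnegrE ?mulr_ge0 ?exprn_ge0 ?(ltW alpha0)//.
  apply: (le_trans (norm_iter_resolvent_normal _ _ _)).
  by rewrite ler_wpM2l ?norm_iter_resolvent_le ?exprn_ge0 ?(ltW alpha0).
rewrite /VSC; case: ifP => lodd.
  move=> [om [-> /VSC_odd1_bound[t t0 tP]]]; exists t => //.
  pose k := l.+1./2.-1.
  (* Here l = 2 k + 1, so l <= 2 m leaves a resolvent beyond the k absorbed ones; in the even case l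
     = 2 k + 2 does the same, and the extra factor alpha comes from [VSC_even1_bound]. *)
  have [j ->] : exists j, m = (k + j.+1)%N.
    by exists (m - k.+1)%N; rewrite /k; lia.
  apply: (le_trans (bias _ _ _)).
  have -> : l.-1 = (k * 2)%N by rewrite /k; lia.
  by rewrite exprM [4 * _]mulrC -[leRHS]mulrA ler_pM2l ?exprn_gt0.
move=> [p [-> /VSC_even1_bound[t t0 tP]]]; exists t => //.
pose k := l./2.-1.
have [j ->] : exists j, m = (k + j.+1)%N.
  by exists (m - k.+1)%N; rewrite /k; lia.
apply: (le_trans (bias _ _ _)).
have -> : l.-1 = (k * 2).+1%N by rewrite /k; lia.
by rewrite [alpha ^+ _.+1]exprSr exprM [4 * _]mulrCA -[leRHS]mulrA ler_pM2l ?exprn_gt0.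
Qed.

End Adjoint.

Theorem theorem3p2 (R : realType) (l m : nat) (l_gt0 : (0 < l)%N)
    (m_gt0 : (0 < m)%N) (le_l_2m : (l <= 2 * m)%N) :
  exists C : R, 0 < C /\
    forall (X Y : hilbertType R) (T : {linear X -> Y}),
    bounded_near T (nbhs (0 : X)) ->
    injective T ->
    ~ {within range T, continuous (inverse T)} ->
    forall (Phi : R -> R) (fdag : X),
    index_function Phi ->
    concave_on_nonneg Phi ->
    VSC T fdag Phi l ->
    forall (alpha delta : R) (gobs : Y),
    0 < alpha -> 0 < delta -> `|gobs - T fdag| <= delta ->
    ((`|iterated_tikhonov T alpha gobs m - fdag| ^+ 2)%:E <=
      C%:E * ((delta ^+ 2 / alpha)%:E +
              (alpha ^+ l.-1)%:E * conjugate_opp Phi (- alpha^-1)))%E.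
Proof.
(* Squaring |e| <= m |w| + |b| costs a factor 2: the noise gets 2 m^2 / 4 and the bias 2 * 4, both
   below this constant. *)
exists (m%:R ^+ 2 + 8); split; first by rewrite ltr_wpDl ?sqr_ge0.
move=> X Y T Tb _ _ Phi fdag _ _ vsc alpha delta gobs alpha0 delta0 noise.
have [t t0 tP] := VSC_bias _ Tb _ alpha0 _ _ _ _ l_gt0 le_l_2m vsc.
set psi_t := - alpha^-1 * t + Phi t in tP.
have psiP : (psi_t%:E <= conjugate_opp Phi (- alpha^-1))%E.
  by apply: ereal_sup_ubound; exists t => //=; rewrite in_itv /= t0.
have C0 : (0 : R) <= m%:R ^+ 2 + 8 by rewrite addr_ge0 ?sqr_ge0.
(* The conjugate may be infinite, so it is first replaced by its real lower bound [psi_t]. *)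
apply: (@le_trans _ _
  ((m%:R ^+ 2 + 8)%:E * ((delta ^+ 2 / alpha)%:E +
                         (alpha ^+ l.-1)%:E * psi_t%:E))%E); last first.
  rewrite lee_wpmul2l ?lee_fin// leeD2l// lee_wpmul2l// lee_fin.
  by rewrite exprn_ge0// ltW.
rewrite -!(EFinM, EFinD) lee_fin.
have := norm_iterated_tikhonov_error _ Tb _ alpha0 (gobs - T fdag) fdag m.
rewrite (addrC (T fdag)) subrK.
have := norm_tikhonov_step_noise _ Tb _ alpha0 (gobs - T fdag).
set w := tikhonov_step _ _ _ _; set e := _ - fdag.
set b := iter _ _ _ in tP * => wP eP.
have w2 : `|w| ^+ 2 <= delta ^+ 2 / alpha / 4.
  apply: (le_trans wP); rewrite -mulrA -invfM (mulrC alpha).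
  rewrite ler_pM2r ?invr_gt0 ?mulr_gt0//.
  by rewrite ler_sqr ?nnegrE// ltW.
have e2 : `|e| ^+ 2 <= 2 * (m%:R ^+ 2 * `|w| ^+ 2) + 2 * `|b| ^+ 2.
  have : `|e| <= m%:R * `|w| + `|b|.
    by rewrite -[e](addrK b) (le_trans (ler_normB _ _))// lerD2r.
  rewrite -ler_sqr ?nnegrE ?addr_ge0 ?mulr_ge0// => /le_trans; apply.
  rewrite -exprMn; have := sqr_ge0 (m%:R * `|w| - `|b|); lra.
apply: (le_trans e2).
have {}w2 := ler_wpM2l (sqr_ge0 m%:R) w2.
have d0 : 0 <= delta ^+ 2 / alpha by rewrite divr_ge0 ?sqr_ge0// ltW.
(* The bias bound itself forces this sign, which allows the coefficient 8 to be enlarged to m^2 +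
   8. *)
have p0 : 0 <= alpha ^+ l.-1 * psi_t.
  by have := le_trans (sqr_ge0 `|b|) tP; rewrite -mulrA pmulr_rge0.
have := mulr_ge0 (sqr_ge0 m%:R) d0; have := mulr_ge0 (sqr_ge0 m%:R) p0.
move: tP w2 d0 p0; rewrite -mulrA.
move: (_ / alpha) (_ * psi_t) (m%:R ^+ 2) => D P M; lra.
Qed.
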